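(* Let $G$ and $H$ be undirected simple graphs on $N=\{1,\dots,n\}$ with $E_G\cap E_H=\{ij,jk\}$, where $i,j,k\in N$ are distinct. (1) If $ik\in E_G\setminus E_H$, then $\mathcal M(G,H)=\mathcal M(G\cap H)^{-1}$. (2) If $ik\in E_H\setminus E_G$, then $\mathcal M(G,H)=\mathcal M(G\cap H)$. (3) If $ik\notin E_G\cup E_H$, then $$\mathcal M_1(G,H)=\{\mathbb 1_n+tE^{ij}:t\in(-1,1)\}\cup\{\mathbb 1_n+tE^{jk}:t\in(-1,1)\}.$$ The Zariski closure of $\mathcal M_1(G,H)$ is a pair of lines intersecting in $\mathbb 1_n$. Thus $\mathcal M_1(G,H)$ is connected (in the Euclidean topology) of dimension one, with reducible Zariski closure.
   Context: $E_G$ denotes the edge set of $G$; $G\cap H$ is the graph on $N$ with edge set $E_G\cap E_H$. $\mathrm{PD}_n$ is the set of real symmetric positive definite $n\times n$ matrices. For a graph $F$ on $N$, $\mathcal M(F)=\{\Sigma\in\mathrm{PD}_n:(\Sigma^{-1})_{st}=0\text{ for all }s\neq t,\ st\notin E_F\}$ and $\mathcal M(F)^{-1}=\{\Sigma^{-1}:\Sigma\in\mathcal M(F)\}=\{\Sigma\in\mathrm{PD}_n:\Sigma_{st}=0\text{ for all }s\ne t,\ st\notin E_F\}$. $\mathcal M(G,H)=\mathcal M(G)\cap\mathcal M(H)^{-1}$, and $\mathcal M_1(G,H)$ is the subset of matrices in $\mathcal M(G,H)$ with all diagonal entries equal to $1$. $\mathbb 1_n$ is the identity matrix and $E^{st}=E_{st}+E_{ts}$,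 where $E_{st}$ has a single $1$ at position $(s,t)$ and zeros elsewhere. Zariski closures are real Zariski closures, and the dimension of a semi-algebraic set is that of its Zariski closure. *)

(* Defs.v *)
From mathcomp Require Import all_boot all_order all_algebra.
From mathcomp Require Import all_classical all_reals all_analysis.
(* not imported: the notations of mpoly clash with those of MathComp-Analysis *)
From mathcomp Require mpoly.

Set Implicit Arguments.
Unset Strict Implicit.
Unset Printing Implicit Defensive.

Import Order.TTheory GRing.Theory Num.Theory.
Import numFieldNormedType.Exports.
Local Open Scope classical_set_scope.
Local Open Scope ring_scope.

Record sgraph (n : nat) := SGraph {
  edges : {set {set 'I_n}};
  edges_card2 : forall e, e \in edges -> #|e| = 2%N
}.

Definition edge n (s t : 'I_n) : {set 'I_n} := [set s; t]%SET.

Lemma edgesI_card2 n (G H : sgraph n) e :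
  e \in (edges G :&: edges H)%SET -> #|e| = 2%N.
Proof. by rewrite finset.inE => /andP[/edges_card2]. Qed.

Definition graphI n (G H : sgraph n) : sgraph n :=
  SGraph (@edgesI_card2 n G H).

Section Models.
Variables (R : realType) (n : nat).
Implicit Types (F G H : sgraph n) (S : 'M[R]_n).

Definition posdef S : Prop :=
  S^T = S /\ forall x : 'cV[R]_n, x != 0 -> 0 < (x^T *m S *m x) 0 0.

Definition model F : set 'M[R]_n :=
  [set S | posdef S /\
    forall s t, s != t -> edge s t \notin edges F -> invmx S s t = 0].

Definition model_inv F : set 'M[R]_n := [set invmx S | S in model F].

Definition dmodel G H : set 'M[R]_n := model G `&` model_inv H.

Definition dmodel1 G H : set 'M[R]_n :=
  [set S | dmodel G H S /\ forall s, S s s = 1].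

Definition Esym (s t : 'I_n) : 'M[R]_n := delta_mx s t + delta_mx t s.

Definition is_line (L : set 'M[R]_n) : Prop :=
  exists A D : 'M[R]_n, D != 0 /\ L = [set A + t *: D | t in [set: R]].

End Models.

Arguments model R {n} F _.
Arguments model_inv R {n} F _.
Arguments dmodel R {n} G H _.
Arguments dmodel1 R {n} G H _.
Arguments Esym R {n} s t.

(* Real Zariski topology on the affine space of n x n matrices, with the
   entries, flattened by mxvec, as the n * n coordinates. *)
Section Zariski.
Variables (R : realType) (n : nat).
Implicit Types (A B Z S : set 'M[R]_n).

Definition mxeval (p : mpoly.mpoly (n * n) R) (M : 'M[R]_n) : R :=
  mpoly.meval (fun i => mxvec M 0 i) p.

Definition zariski_closed Z : Prop :=
  exists P : set (mpoly.mpoly (n * n) R),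
    Z = [set M | forall p, P p -> mxeval p M = 0].

Definition zariski_closure S : set 'M[R]_n := smallest zariski_closed S.

Definition zariski_reducible Z : Prop :=
  exists A B, [/\ zariski_closed A, zariski_closed B, A `<` Z, B `<` Z
                & Z = A `|` B].

Definition zariski_irreducible Z : Prop := Z !=set0 /\ ~ zariski_reducible Z.

Definition zariski_chain Z (m : nat) (C : nat -> set 'M[R]_n) : Prop :=
  (forall k, (k <= m)%N ->
     [/\ zariski_closed (C k), zariski_irreducible (C k) & C k `<=` Z]) /\
  (forall k, (k < m)%N -> C k `<` C k.+1).

(* Krull dimension of a Zariski closed set Z *)
Definition zariski_dim Z (d : nat) : Prop :=
  (exists C, zariski_chain Z d C) /\
  (forall m C, zariski_chain Z m C -> (m <= d)%N).

Definition semialg_dim S (d : nat) : Prop := zariski_dim (zariski_closure S) d.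

End Zariski.

(* Main.v *)
(** If K is the inverse of S in M(G,H), then S_st K_ts = 0 for all distinct s, t
    not joined by an edge of both graphs.  Hence a vertex s isolated in the
    intersection of G and H satisfies S_ss K_ss = 1.  Equality in
    S_ss K_ss >= 1 forces the s-th rows of S and K to be diagonal, so that only
    the block indexed by i, j, k matters.  This gives (1), and (2) follows by
    exchanging S and K.  In (3), the (i,k) entry of S K = 1 reads
    S_ij K_jk = 0, and K_jk = 0 isolates k, so S_jk = 0.

    A polynomial restricted to a line is a univariate polynomial, so it
    vanishes on a line as soon as it does on a segment; lines are therefore
    irreducible, and their proper closed subsets are finite.  Finite irreducible
    sets are points, hence chains in a union of two lines have length at most
    one. *)

Require Import Defs.
From mathcomp Require Import all_boot all_order all_algebra.
From mathcomp Require Import all_classical all_reals all_analysis.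
From mathcomp Require Import ring lra.
From mathcomp Require mpoly.
(* the ring structure of polynomials, without the clashing notations *)
Import (canonicals) mpoly.

Set Implicit Arguments.
Unset Strict Implicit.
Unset Printing Implicit Defensive.

Import Order.TTheory GRing.Theory Num.Theory.
Import numFieldNormedType.Exports.
Local Open Scope classical_set_scope.
Local Open Scope ring_scope.

(** * Positive definite matrices and isolated rows *)

Section PositiveDefinite.
Variables (R : realType) (n : nat).
Implicit Types (S : 'M[R]_n) (s t : 'I_n) (x : 'cV[R]_n).

(** A nonzero row [v] with [v *m S = 0] would make the quadratic form vanish at [v^T]. *)
Lemma posdef_unitmx S : posdef S -> S \in unitmx.
Proof.
move=> [_ Spos]; rewrite -row_free_unit -kermx_eq0; apply: contraT.
move=> /rowV0Pn[v /sub_kermxP vS0 v0].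
have := Spos v^T; rewrite trmx_eq0 => /(_ v0).
by rewrite trmxK vS0 mul0mx mxE ltxx.
Qed.

(** The form of [invmx S] at [x] is the form of [S] at [invmx S *m x]. *)
Lemma posdef_invmx S : posdef S -> posdef (invmx S).
Proof.
move=> Spd; have Su := posdef_unitmx Spd; case: Spd => Ssym Spos.
split=> [|x x0]; first by rewrite trmx_inv Ssym.
have := Spos (invmx S *m x); rewrite trmx_mul trmx_inv Ssym.
rewrite -!mulmxA mulKVmx // !mulmxA; apply.
by apply: contraNneq x0 => y0; rewrite -(mulKVmx Su x) y0 mulmx0.
Qed.

Lemma posdef_symE S s t : posdef S -> S s t = S t s.
Proof. by move=> [Ssym _]; rewrite -{1}Ssym mxE. Qed.

Lemma mx11E : (forall B C : 'M[R]_1, (B + C) 0 0 = B 0 0 + C 0 0) *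
  (forall (a : R) (B : 'M[R]_1), (a *: B) 0 0 = a * B 0 0) *
  (forall B : 'M[R]_1, (- B) 0 0 = - B 0 0).
Proof. by split=> [|B]; [split=> [B C|a B]|]; rewrite mxE. Qed.

Lemma bilinear_delta S s t :
  ((delta_mx s 0 : 'cV[R]_n)^T *m (S *m (delta_mx t 0 : 'cV[R]_n))) 0 0 = S s t.
Proof. by rewrite trmx_delta -rowE -colE !mxE. Qed.

Lemma posdef_lt1 S s t :
  s != t -> posdef S -> S s s = 1 -> S t t = 1 -> -1 < S s t < 1.
Proof.
move=> st Spd Ss St; have form a : 0 < 1 + a * S s t *+ 2 + a ^+ 2.
  have := Spd.2 (delta_mx s 0 + a *: delta_mx t 0).
  have -> : delta_mx s 0 + a *: delta_mx t 0 != 0 :> 'cV[R]_n.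
    apply: contra_neq (@oner_neq0 R) => /matrixP/(_ s 0).
    by rewrite !mxE !eqxx (negbTE st) mulr0 addr0.
  move=> /(_ isT); rewrite -mulmxA linearD linearZ /= mulmxDl -!scalemxAl.
  rewrite !mulmxDr -!scalemxAr !mx11E !bilinear_delta.
  by rewrite (posdef_symE t s Spd) Ss St; congr (_ < _); ring.
(* The values at [a = 1] and [a = -1] are [2 + 2 * S s t] and [2 - 2 * S s t]. *)
by have := form 1; have := form (-1); lra.
Qed.

(* For any positive definite [S] one has [S s s * invmx S s s >= 1]: the
   quadratic form takes the value [S s s * (S s s * invmx S s s - 1)] at the
   vector [x] below. *)
Lemma invmx_diag_isolated S s : posdef S -> S s s * invmx S s s = 1 ->
  forall t, t != s -> invmx S t s = 0.
Proof.
move=> Spd SK1 t ts; have Su := posdef_unitmx Spd.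
have [Ksym _] := posdef_invmx Spd.
pose e : 'cV[R]_n := delta_mx s 0.
pose x := e - S s s *: (invmx S *m e).
have x0 : x = 0.
  apply/eqP; apply: contraT => /(Spd.2 x).
  have Sx : S *m x = S *m e - S s s *: e.
    by rewrite mulmxBr -scalemxAr mulKVmx.
  have xE : x^T = e^T - S s s *: (e^T *m invmx S).
    by rewrite linearB linearZ /= trmx_mul Ksym.
  rewrite -mulmxA Sx xE mulmxBl !mulmxBr -!scalemxAl -!scalemxAr -!mulmxA.
  rewrite mulKmx // !mx11E (bilinear_delta S) (bilinear_delta (invmx S)).
  have -> : (e^T *m e) 0 0 = 1.
    by rewrite trmx_delta mul_delta_mx mxE !eqxx.
  by rewrite SK1 mulr1 subrr ltxx.
have /eqP : x t 0 = 0 by rewrite x0 mxE.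
rewrite /x /e -colE !mxE (negbTE ts) sub0r oppr_eq0 mulf_eq0 => /orP[]/eqP//.
by move=> S0; move: SK1; rewrite S0 mul0r => /eqP; rewrite eq_sym oner_eq0.
Qed.

(** Row [s] of [S *m invmx S = 1] reduces to its diagonal terms [S s s * invmx S s u]. The entry
    [u = s] forces [S s s != 0], so the entries [u != s] force zeros. *)
Lemma invmx_row_isolated S s : S \in unitmx ->
  (forall t, t != s -> S s t = 0) -> forall t, t != s -> invmx S s t = 0.
Proof.
move=> Su S0 t ts.
have SK u : (s == u)%:R = S s s * invmx S s u.
  have /matrixP/(_ s u) := mulmxV Su; rewrite !mxE => <-.
  by rewrite (bigD1 s) //= big1 ?addr0 // => v vs; rewrite S0 ?mul0r.
have := SK t; rewrite eq_sym (negbTE ts) => /esym/eqP; rewrite mulf_eq0.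
move=> /orP[/eqP Ss0|/eqP//].
by have := SK s; rewrite Ss0 mul0r eqxx => /eqP; rewrite oner_eq0.
Qed.

Lemma posdef_1DEsym s t (a : R) : s != t -> -1 < a < 1 ->
  posdef (1%:M + a *: Esym R s t).
Proof.
move=> st a1; split=> [|x x0].
  by rewrite linearD linearZ /= tr_scalar_mx /Esym linearD /= !trmx_delta addrC
             [X in _ *: X]addrC [LHS]addrC.
have sqr (u : 'I_n) : 0 <= x u 0 ^+ 2 by exact: sqr_ge0.
have formE : (x^T *m (1%:M + a *: Esym R s t) *m x) 0 0 =
    \sum_u x u 0 ^+ 2 + a * (x s 0 * x t 0) *+ 2.
  have deltaE u v : (x^T *m (delta_mx u v *m x)) 0 0 = x u 0 * x v 0.
    rewrite -(mul_delta_mx (0 : 'I_1)) !mulmxA -mulmxA -colE -rowE.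
    by rewrite !mxE big_ord1 !mxE.
  rewrite -mulmxA mulmxDl mul1mx mulmxDr -scalemxAl -scalemxAr mulmxDl mulmxDr.
  rewrite !mx11E !deltaE; congr (_ + _); last by ring.
  by rewrite mxE; apply: eq_bigr => u _; rewrite mxE expr2.
rewrite formE.
have sum_gt0 : 0 < \sum_u x u 0 ^+ 2.
  rewrite lt_neqAle sumr_ge0 // andbT eq_sym; apply: contra x0.
  rewrite psumr_eq0 // => /allP x0; apply/eqP/colP => u; rewrite mxE.
  by apply/eqP; rewrite -sqrf_eq0; exact: x0 (mem_index_enum u).
have sum_ge : x s 0 ^+ 2 + x t 0 ^+ 2 <= \sum_u x u 0 ^+ 2.
  rewrite (bigD1 s) //= (bigD1 t) 1?eq_sym //= addrA lerDl.
  exact: sumr_ge0.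
move: sum_gt0 sum_ge; move: (\sum_u _) (x s 0) (x t 0) => N b c N0 Nbc.
(* In both cases the form [N + 2abc] is the sum of the three quantities [P], [Q] and [T], the first
   positive and the others nonnegative. *)
have [a0|a0] := leP 0 a.
- have P : 0 < (1 - a) * N by rewrite mulr_gt0 //; lra.
  have Q : 0 <= a * (N - (b ^+ 2 + c ^+ 2)) by rewrite mulr_ge0 // subr_ge0.
  have T : 0 <= a * (b + c) ^+ 2 by rewrite mulr_ge0 ?sqr_ge0.
  by nra.
- have P : 0 < (1 + a) * N by rewrite mulr_gt0 //; lra.
  have Q : 0 <= - a * (N - (b ^+ 2 + c ^+ 2)).
    by rewrite mulr_ge0 ?subr_ge0 // oppr_ge0 ltW.
  have T : 0 <= - a * (b - c) ^+ 2 by rewrite mulr_ge0 ?sqr_ge0 // oppr_ge0 ltW.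
  by nra.
Qed.

End PositiveDefinite.

(** * Entrywise descriptions of the models, and isolated vertices *)

Section Models.
Variables (R : realType) (n : nat).
Implicit Types (F G H : sgraph n) (S : 'M[R]_n) (i j k s t u : 'I_n).

Lemma edgeC s t : edge s t = edge t s.
Proof. exact: finset.setUC. Qed.

Lemma in_edge u s t : (u \in edge s t) = (u == s) || (u == t).
Proof. by rewrite /edge !finset.inE. Qed.

Lemma edge_inj s t u v : u != v -> edge u v = edge s t ->
  u = s /\ v = t \/ u = t /\ v = s.
Proof.
move=> uv uvst; have : (u \in edge s t) && (v \in edge s t).
  by rewrite -uvst !in_edge !eqxx orbT.
rewrite !in_edge => /andP[/orP[]/eqP us /orP[]/eqP vs]; [|by left|by right|];
by rewrite us vs eqxx in uv.
Qed.

Lemma model_invE F S : model_inv R F S <->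
  posdef S /\ forall s t, s != t -> edge s t \notin edges F -> S s t = 0.
Proof.
split=> [[T [Tpd T0] <-]|[Spd S0]]; first by split=> //; exact: posdef_invmx.
exists (invmx S); last exact: invmxK.
by split; [exact: posdef_invmx|rewrite invmxK].
Qed.

Lemma dmodelE G H S : dmodel R G H S <-> [/\ posdef S,
    forall s t, s != t -> edge s t \notin edges G -> invmx S s t = 0
  & forall s t, s != t -> edge s t \notin edges H -> S s t = 0].
Proof.
split=> [[[Spd SG] /model_invE[_ SH]]|[Spd SG SH]]; first by [].
by split; [|apply/model_invE].
Qed.

Lemma model_invmx F S : model R F (invmx S) <-> model_inv R F S.
Proof.
split=> [FS|[T FT <-]]; last by rewrite invmxK.
by exists (invmx S); [|rewrite invmxK].
Qed.

(** Inversion exchanges the two graphs, which reduces case (2) to case (1). *)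
Lemma dmodel_invmx G H S : dmodel R G H (invmx S) <-> dmodel R H G S.
Proof.
rewrite /dmodel /= model_invmx -(model_invmx H (invmx S)) invmxK.
by split=> -[].
Qed.

Lemma dmodel_isolated G H S s : dmodel R G H S ->
  (forall t, t != s -> edge s t \notin (edges G :&: edges H)%SET) ->
  forall t, t != s -> S s t = 0 /\ invmx S s t = 0.
Proof.
move=> /dmodelE[Spd SG SH] sGH.
have Su := posdef_unitmx Spd; have Kpd := posdef_invmx Spd.
have K0 t : t != s -> invmx S s t = 0.
  move=> ts; rewrite (posdef_symE _ _ Kpd); apply: invmx_diag_isolated ts => //.
  (* In the diagonal entry at [s] of [S *m invmx S = 1], every term with [u != s] vanishes: a pair
     missing from [G] kills the factor from [invmx S], a pair missing from [H] the factor from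
     [S]. *)
  have /matrixP/(_ s s) := mulmxV Su; rewrite !mxE eqxx -[true%:R]/1 => <-.
  rewrite (bigD1 s) //= big1 ?addr0 // => u us.
  have := sGH u us; rewrite finset.inE negb_and => /orP[uG|uH].
    by rewrite (SG u s us) ?mulr0 // edgeC.
  by rewrite SH ?mul0r // eq_sym.
move=> t ts; split; last exact: K0.
(* [S] is the inverse of [invmx S], whose row [s] is now known to be diagonal. *)
rewrite -[S]invmxK; apply: invmx_row_isolated ts => //.
by rewrite unitmx_inv.
Qed.

End Models.

(** * Cases (1) and (2): the pair [ik] is an edge of exactly one graph *)

Section PathIntersection.
Variables (R : realType) (n : nat) (i j k : 'I_n).
Implicit Types (F G H : sgraph n) (S : 'M[R]_n) (s t u : 'I_n).

Let path_edges := [set edge i j; edge j k]%SET.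

Lemma edge_path_mem s t : edge s t \in path_edges -> s \in [:: i; j; k].
Proof.
have sst : s \in edge s t by rewrite in_edge eqxx.
rewrite !finset.inE => /orP[]/eqP stE; move: sst; rewrite stE in_edge;
by move=> /orP[]->; rewrite ?orbT.
Qed.

Lemma edge_path_cases s t : s != t ->
  s \in [:: i; j; k] -> t \in [:: i; j; k] ->
  edge s t \in path_edges \/ edge s t = edge i k.
Proof.
move=> st; rewrite !inE.
move=> /or3P[]/eqP sE /or3P[]/eqP tE; move: st; rewrite sE tE ?eqxx // => _;
  first [by left; rewrite ?eqxx ?orbT | by left; rewrite edgeC ?eqxx ?orbT
        |by right|by right; rewrite edgeC].
Qed.

Lemma dmodel_path_isolated G H S s : (edges G :&: edges H)%SET = path_edges ->
  dmodel R G H S -> s \notin [:: i; j; k] ->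
  forall t, t != s -> S s t = 0 /\ invmx S s t = 0.
Proof.
move=> hGH GHS s_path; apply: dmodel_isolated GHS _ => t _; rewrite hGH.
by apply: contra s_path; exact: edge_path_mem.
Qed.

(** Pairs meeting a vertex off the path are settled by isolation, so only [ik] is at stake: as a
    non-edge of [H] it forces [S i k = 0], as an edge of [G] it leaves [invmx S i k] free. [F] is
    kept abstract so that the result also applies with [G] and [H] exchanged. *)
Lemma dmodel_path_inv F G H : (edges G :&: edges H)%SET = path_edges ->
  edges F = path_edges -> edge i k \in (edges G :\: edges H)%SET ->
  dmodel R G H = model_inv R F.
Proof.
move=> hGH hF; rewrite finset.inE => /andP[ikH ikG].
have [FG FH] : {subset edges F <= edges G} /\ {subset edges F <= edges H}.
  by split=> e; rewrite hF -hGH finset.inE => /andP[].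
apply/seteqP; split=> S.
  move=> GHS; apply/model_invE; have /dmodelE[Spd _ SH] := GHS.
  split=> // s t st; rewrite hF => stF.
  have [s_path|s_path] := boolP (s \in [:: i; j; k]); last first.
    by have [] := dmodel_path_isolated hGH GHS s_path (t := t);
       rewrite 1?eq_sym.
  have [t_path|t_path] := boolP (t \in [:: i; j; k]); last first.
    rewrite (posdef_symE _ _ Spd).
    by have [] := dmodel_path_isolated hGH GHS t_path st.
  apply: SH => //; have [|->//] := edge_path_cases st s_path t_path.
  by rewrite (negbTE stF).
move=> /model_invE[Spd SF]; apply/dmodelE; split=> // s t st.
  move=> stG; have Kpd := posdef_invmx Spd.
  (* A vertex off the path is isolated in [S], hence in its inverse. *)
  have K0 u v : u \notin [:: i; j; k] -> v != u -> invmx S u v = 0.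
    move=> u_path; apply: invmx_row_isolated; first exact: posdef_unitmx.
    move=> w wu; apply: SF; first by rewrite eq_sym.
    by rewrite hF; apply: contra u_path; exact: edge_path_mem.
  have [s_path|s_path] := boolP (s \in [:: i; j; k]); last first.
    by rewrite K0 // eq_sym.
  have [t_path|t_path] := boolP (t \in [:: i; j; k]); last first.
    by rewrite (posdef_symE _ _ Kpd) K0.
  have [|stE] := edge_path_cases st s_path t_path.
    by rewrite -hF => /FG; rewrite (negbTE stG).
  by move: stG; rewrite stE ikG.
by move=> stH; apply: SF => //; apply: contra stH; exact: FH.
Qed.

Lemma dmodel_path F G H : (edges G :&: edges H)%SET = path_edges ->
  edges F = path_edges -> edge i k \in (edges H :\: edges G)%SET ->
  dmodel R G H = model R F.
Proof.
rewrite finset.setIC => hGH hF ikHG; have E := dmodel_path_inv hGH hF ikHG.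
apply/seteqP; split=> S.
  by move=> /(dmodel_invmx H G S).2; rewrite E => /model_invmx; rewrite invmxK.
move=> FS; apply/(dmodel_invmx H G S); rewrite E; apply/model_invmx.
by rewrite invmxK.
Qed.

End PathIntersection.

(** * Segments through the identity matrix *)

Section Segments.
Variables (R : realType) (n : nat).
Implicit Types (G H : sgraph n) (S : 'M[R]_n) (s t u v : 'I_n).

Lemma EsymE s t u v : Esym R s t u v =
  ((u == s) && (v == t))%:R + ((u == t) && (v == s))%:R.
Proof. by rewrite !mxE. Qed.

Lemma Esym_edge0 s t u v : edge u v != edge s t -> Esym R s t u v = 0.
Proof.
move=> uvst; rewrite EsymE.
case: andP => [[/eqP us /eqP vt]|_]; first by rewrite us vt eqxx in uvst.
case: andP => [[/eqP ut /eqP vs]|_]; last exact: addr0.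
by rewrite ut vs edgeC eqxx in uvst.
Qed.

Lemma Esym_neq0 s t : s != t -> Esym R s t != 0.
Proof.
move=> st; apply: contra_neq (@oner_neq0 R) => /matrixP/(_ s t).
by rewrite EsymE !eqxx (negbTE st) mxE addr0.
Qed.

Definition segment s t : set 'M[R]_n :=
  [set 1%:M + a *: Esym R s t | a in `](-1), 1[].

(** Every vertex other than [s] and [t] is isolated in [S], hence in [invmx S], so the inverse too
    has no off-diagonal entry outside the pair [st]. *)
Lemma segment_dmodel1 G H s t : s != t ->
  edge s t \in (edges G :&: edges H)%SET -> segment s t `<=` dmodel1 R G H.
Proof.
move=> st; rewrite finset.inE => /andP[stG stH] S [a].
rewrite /= in_itv /= => a1 aS.
have Spd : posdef S by rewrite -aS; exact: posdef_1DEsym.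
have SE u v : S u v = (u == v)%:R +
    a * (((u == s) && (v == t))%:R + ((u == t) && (v == s))%:R).
  by rewrite -aS !mxE.
have S0 u v : u != v -> edge u v != edge s t -> S u v = 0.
  move=> uv uvst; rewrite -aS mxE [X in _ + X]mxE Esym_edge0 // mulr0 addr0.
  by rewrite mxE (negbTE uv).
have iso u : u != s -> u != t -> forall v, v != u -> invmx S u v = 0.
  move=> us ut; apply: invmx_row_isolated; first exact: posdef_unitmx.
  by move=> v vu; rewrite SE eq_sym (negbTE vu) (negbTE us) (negbTE ut) !(addr0, mulr0).
have Kpd := posdef_invmx Spd.
split; last first.
  move=> u; rewrite SE eqxx; have [->|us] := eqVneq u s.
    by rewrite (negbTE st) /= addr0 mulr0 addr0.
  by rewrite andbF addr0 mulr0 addr0.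
apply/dmodelE; split=> // u v uv uvGH; last first.
  by apply: S0 => //; apply: contraNneq uvGH => ->.
have uvst : edge u v != edge s t by apply: contraNneq uvGH => ->.
have [ust|] := boolP (u \in edge s t); last first.
  rewrite in_edge negb_or => /andP[us ut]; apply: iso => //.
  by rewrite eq_sym.
have [vst|] := boolP (v \in edge s t); last first.
  rewrite in_edge negb_or => /andP[vs vt]; rewrite (posdef_symE _ _ Kpd).
  exact: iso.
(* Two vertices of the edge [st] either coincide or form that edge; both are excluded. *)
move: ust vst uvst uv; rewrite !in_edge.
by move=> /orP[]/eqP-> /orP[]/eqP->; rewrite ?[edge t s]edgeC ?eqxx.
Qed.

Lemma segment_connected s t : connected (segment s t).
Proof.
apply: connected_continuous_connected.
  by apply/connected_intervalP => x y; exact: interval_is_interval.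
apply: continuous_subspaceT => a.
by apply: cvgD; [exact: cvg_cst|exact: scalel_continuous].
Qed.

End Segments.
Arguments segment R {n} s t.

(** * Case (3): the unit-diagonal model as a union of two segments *)

Lemma dmodel1_path (R : realType) n (G H : sgraph n) (i j k : 'I_n) :
  i != j -> j != k -> i != k ->
  (edges G :&: edges H)%SET = [set edge i j; edge j k]%SET ->
  edge i k \notin (edges G :|: edges H)%SET ->
  dmodel1 R G H = segment R i j `|` segment R j k.
Proof.
move=> ij jk ik hGH; rewrite finset.inE negb_or => /andP[ikG ikH].
apply/seteqP; split; last first.
  by move=> S []; apply: segment_dmodel1 => //; rewrite hGH !finset.inE eqxx ?orbT.
move=> S [GHS S1]; have /dmodelE[Spd SG SH] := GHS.
have Su := posdef_unitmx Spd; have Kpd := posdef_invmx Spd.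
have iso u v : u \notin [:: i; j; k] -> u != v -> S u v = 0 /\ invmx S u v = 0.
  by move=> up uv; apply: dmodel_path_isolated hGH GHS up _ _;
     rewrite // eq_sym.
have Sik : S i k = 0 by exact: SH.
have Kik : invmx S i k = 0 by exact: SG.
(* In the [(i, k)] entry of [S *m invmx S = 1], the term [u = i] dies by [Kik], [u = k] by [Sik],
   and the vertices off the path by isolation; only [u = j] survives. *)
have SK0 : S i j * invmx S j k = 0.
  have /matrixP/(_ i k) := mulmxV Su.
  rewrite !mxE (negbTE ik) -[false%:R]/0 => <-.
  rewrite (bigD1 j) //= big1 ?addr0 // => u uj.
  have [->|ui] := eqVneq u i; first by rewrite Kik mulr0.
  have [->|uk] := eqVneq u k; first by rewrite Sik mul0r.
  have [|//|Sui _] := iso u i; first by rewrite !inE !negb_or ui uj.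
  by rewrite (posdef_symE _ _ Spd) Sui mul0r.
have S0 u v :
    u != v -> edge u v != edge i j -> edge u v != edge j k -> S u v = 0.
  move=> uv uvij uvjk.
  have [up|/iso/(_ uv)[] //] := boolP (u \in [:: i; j; k]).
  have [vp|vp] := boolP (v \in [:: i; j; k]); last first.
    by rewrite (posdef_symE _ _ Spd); have [] := iso v u vp; rewrite 1?eq_sym.
  have [|uvik] := edge_path_cases uv up vp.
    by rewrite !finset.inE (negbTE uvij) (negbTE uvjk).
  by apply: SH => //; rewrite uvik.
(* With unit diagonal and a single off-diagonal pair, the parameter is the entry [S s t] itself,
   bounded by positive definiteness. *)
have seg s t : s != t ->
    (forall u v, u != v -> edge u v != edge s t -> S u v = 0) ->
    segment R s t S.
  move=> st Sst; exists (S s t).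
    by rewrite /= in_itv /=; exact: posdef_lt1.
  apply/matrixP => u v; rewrite mxE [X in _ + X]mxE mxE.
  have [->|uv] := eqVneq u v.
    rewrite S1 Esym_edge0 ?mulr0 ?addr0 //; apply: contraNneq st => vst.
    have : (s \in edge v v) && (t \in edge v v).
      by rewrite vst !in_edge !eqxx orbT.
    by rewrite !in_edge !orbb => /andP[/eqP-> /eqP->].
  rewrite add0r; have [uvst|uvst] := eqVneq (edge u v) (edge s t); last first.
    by rewrite Esym_edge0 // mulr0 Sst.
  have [[-> ->]|[-> ->]] := edge_inj uv uvst; rewrite EsymE !eqxx.
    by rewrite (negbTE st) addr0 mulr1.
  by rewrite eq_sym (negbTE st) add0r mulr1 (posdef_symE _ _ Spd).
have /orP[/eqP Sij|/eqP Kjk] : (S i j == 0) || (invmx S j k == 0).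
  by rewrite -mulf_eq0 SK0.
- right; apply: seg => // u v uv uvjk.
  have [uvij|uvij] := eqVneq (edge u v) (edge i j); last exact: S0.
  by have [[-> ->]|[-> ->]] := edge_inj uv uvij; rewrite ?(posdef_symE j _ Spd).
left; apply: seg => // u v uv uvij.
have [uvjk|uvjk] := eqVneq (edge u v) (edge j k); last exact: S0.
(* [Kjk] and [Kik] isolate [k] in [invmx S], hence in its inverse [S]. *)
have Skj : S k j = 0.
  rewrite -[S]invmxK; apply: invmx_row_isolated; rewrite ?unitmx_inv // => t tk.
  have [->|tj] := eqVneq t j; first by rewrite (posdef_symE _ _ Kpd).
  have [->|ti] := eqVneq t i; first by rewrite (posdef_symE _ _ Kpd).
  rewrite (posdef_symE _ _ Kpd).
  by have [] := iso t k; rewrite // !inE !negb_or ti tj.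
by have [[-> ->]|[-> ->]] := edge_inj uv uvjk; rewrite ?(posdef_symE j _ Spd).
Qed.

(** * Lines in the Zariski topology: closedness, irreducibility, dimension *)

Section ZariskiLines.
Variables (R : realType) (n : nat).
Implicit Types (A D M x : 'M[R]_n) (Z B C S : set 'M[R]_n).
Implicit Types p q : mpoly.mpoly (n * n) R.

(** The direction may be zero, so that points are degenerate lines and inherit the results on
    lines. *)
Definition mxline A D : set 'M[R]_n := [set A + t *: D | t in [set: R]].

Lemma mem_line A D t : mxline A D (A + t *: D).
Proof. by exists t. Qed.

Lemma mxline0 A : mxline A 0 = [set A].
Proof.
apply/seteqP; split=> M /=; first by move=> [t _ <-]; rewrite scaler0 addr0.
by move=> ->; exists 0 => //; rewrite scaler0 addr0.
Qed.

Definition vanish p Z := forall M, Z M -> mxeval p M = 0.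

Lemma mxevalM p q M : mxeval (p * q) M = mxeval p M * mxeval q M.
Proof. exact: mpoly.mevalM. Qed.

(** The products of an equation of [B] and one of [C] cut out the union, since [R] is an integral
    domain. *)
Lemma zariski_closedU B C :
  zariski_closed B -> zariski_closed C -> zariski_closed (B `|` C).
Proof.
move=> [P ->] [Q ->]; exists [set r | exists p q, [/\ P p, Q q & r = p * q]].
apply/seteqP; split=> M /=.
  by move=> BC r [p [q [Pp Qq ->]]]; rewrite mxevalM;
     case: BC => [/(_ _ Pp)|/(_ _ Qq)] ->; rewrite ?mul0r ?mulr0.
move=> PQ; apply/or_asboolP; rewrite -implyNb; apply/implyP.
move=> /asboolPn/existsNP[p /not_implyP[Pp pM]]; apply/asboolP => q Qq.
have : mxeval (p * q) M = 0 by apply: PQ; exists p, q.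
by rewrite mxevalM => /eqP; rewrite mulf_eq0 => /orP[/eqP|/eqP].
Qed.

Lemma zariski_closedI B C :
  zariski_closed B -> zariski_closed C -> zariski_closed (B `&` C).
Proof.
move=> [P ->] [Q ->]; exists (P `|` Q); apply/seteqP; split=> M /=.
  by move=> [PM QM] p [/PM|/QM].
by move=> PQ; split=> p Pp; apply: PQ; [left|right].
Qed.

Lemma zariski_closed_line A D : zariski_closed (mxline A D).
Proof.
pose coord M c := mxvec M 0 c.
have coordD M N c : coord (M + N) c = coord M c + coord N c.
  by rewrite /coord linearD mxE.
have coordZ a M c : coord (a *: M) c = a * coord M c.
  by rewrite /coord linearZ mxE.
have coordB M N c : coord (M - N) c = coord M c - coord N c.
  by rewrite /coord linearB !mxE.
pose V c : mpoly.mpoly (n * n) R :=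
  mpoly.mpolyX R (mpoly.mnm1 c) - mpoly.mpolyC (n * n) (coord A c).
have VE c M : mxeval (V c) M = coord (M - A) c.
  by rewrite /mxeval mpoly.mevalB mpoly.mevalXU mpoly.mevalC coordB.
(* The equations are the 2 by 2 minors of the pair [M - A], [D], which say that the two are
   parallel. For [D = 0] these are trivial, and the coordinates of [M - A] replace them. *)
exists (if pselect (D = 0) then range V
  else [set r | exists c d, r = coord D d *: V c - coord D c *: V d]).
case: pselect => D0.
  apply/seteqP; split=> M /=.
    by move=> [t _ <-] _ [c _ <-]; rewrite VE D0 scaler0 addr0 subrr /coord
      linear0 mxE.
  move=> VM; exists 0 => //; rewrite scale0r addr0; apply/esym/eqP.
  rewrite -subr_eq0 -(inj_eq (can_inj mxvecK)) linear0; apply/eqP/rowP => c.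
  by rewrite mxE; have := VM (V c); rewrite VE; apply; exists c.
apply/seteqP; split=> M /=.
  move=> [t _ <-] _ [c [d ->]]; rewrite /mxeval mpoly.mevalB !mpoly.mevalZ.
  rewrite -!/(mxeval _ _) !VE.
  have -> : A + t *: D - A = t *: D by rewrite addrAC subrr add0r.
  by rewrite !coordZ; ring.
move=> VM.
have /rV0Pn[d Dd] : mxvec D != 0 by rewrite mxvec_eq0; exact/eqP.
(* The parameter is read off at a coordinate [d] where [D] is nonzero. *)
exists (coord (M - A) d / coord D d) => //.
apply: (can_inj mxvecK); apply/rowP => c.
have : mxeval (coord D d *: V c - coord D c *: V d) M = 0.
  by apply: VM; exists c, d.
rewrite /mxeval mpoly.mevalB !mpoly.mevalZ -!/(mxeval _ _) !VE !coordB.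
rewrite -!/(coord _ _) coordD coordZ -/(coord D d) in Dd *.
move: Dd; move: (coord D d) (coord D c) (coord M c) (coord M d).
move: (coord A c) (coord A d).
move=> Ac Ad d' c' Mc Md d0 /eqP; rewrite subr_eq0 => /eqP E; apply: (mulfI d0).
have -> : d' * (Ac + (Md - Ad) / d' * c') = d' * Ac + c' * (Md - Ad) by field.
by rewrite -E; ring.
Qed.

Lemma zariski_closed1 A : zariski_closed [set A].
Proof. by rewrite -mxline0; exact: zariski_closed_line. Qed.

Lemma zariski_closed_seq (s : seq 'M[R]_n) : zariski_closed [set` s].
Proof.
elim: s => [|A s IHs].
  (* The empty set is the zero set of the constant [1]. *)
  exists [set 1]; apply/seteqP; split=> M //= /(_ 1 erefl).
  by rewrite /mxeval mpoly.meval1 => /eqP; rewrite oner_eq0.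
suff -> : [set` A :: s] = [set A] `|` [set` s].
  exact: zariski_closedU (zariski_closed1 A) IHs.
apply/seteqP; split=> M /=; rewrite inE.
  by move=> /orP[/eqP|]; [left|right].
by case=> [->|->]; rewrite ?eqxx ?orbT.
Qed.

(** The pullback of [p] along the parametrization of the line by ['X]. *)
Definition line_poly A D p : {poly R} :=
  mpoly.mmap polyC (fun c => (mxvec A 0 c)%:P + mxvec D 0 c *: 'X) p.

Lemma horner_line_poly A D p t : (line_poly A D p).[t] = mxeval p (A + t *: D).
Proof.
rewrite /mxeval mpoly.mevalE /line_poly /mpoly.mmap horner_sum.
apply: eq_bigr => m _; rewrite hornerM hornerC /mpoly.mmap1 horner_prod.
congr (_ * _); apply: eq_bigr => c _.
by rewrite horner_exp !hornerE linearD linearZ !mxE [t * _]mulrC.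
Qed.

Lemma poly_roots_seq (q : {poly R}) :
  q != 0 -> exists s : seq R, forall t, root q t -> t \in s.
Proof.
have [m] := ubnP (size q); elim: m q => // m IHm q qm q0.
have [[a qa]|nroot] := pselect (exists a, root q a); last first.
  by exists [::] => t qt; case: nroot; exists t.
have /factor_theorem[q' qE] := qa.
have q'0 : q' != 0 by apply: contraNneq q0 => q'0; rewrite qE q'0 mul0r.
have [|s sq'] := IHm q' _ q'0.
  by move: qm; rewrite qE size_Mmonic ?monicXsubC // size_XsubC addn2.
exists (a :: s) => t; rewrite qE rootM root_XsubC inE => /orP[/sq' ->|->] //.
by rewrite orbT.
Qed.

Lemma poly_seq_eq0 (q : {poly R}) (a b : R) :
  a < b -> (forall t, a < t < b -> q.[t] = 0) -> q = 0.
Proof.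
move=> ab q0; apply/eqP; apply: contraT => /poly_roots_seq[s qs].
(* Denominators start at 2 to keep [u m] strictly between [a] and [b]; [size s + 1] such points are
   too many for the list [s] of roots. *)
pose u m : R := a + (b - a) / m.+2%:R.
have us : {subset [seq u m | m <- iota 0 (size s).+1] <= s}.
  move=> _ /mapP[m _ ->]; apply: qs; apply/eqP/q0; rewrite /u.
  rewrite ltrDl divr_gt0 ?subr_gt0 //= -ltrBrDl ltr_pdivrMr // ltr_pMr //.
    by rewrite ltr1n.
  by rewrite subr_gt0.
have : uniq [seq u m | m <- iota 0 (size s).+1].
  rewrite map_inj_uniq ?iota_uniq // => m1 m2 /addrI /mulfI.
  rewrite subr_eq0 gt_eqF // => /(_ isT) /invr_inj /eqP.
  by rewrite eqr_nat => /eqP[].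
by move=> /uniq_leq_size/(_ us); rewrite size_map size_iota ltnn.
Qed.

Lemma vanish_line A D p (a b : R) : a < b ->
  vanish p [set A + t *: D | t in `]a, b[ ] -> vanish p (mxline A D).
Proof.
move=> ab p0 _ [t _ <-]; rewrite -horner_line_poly.
suff -> : line_poly A D p = 0 by rewrite horner0.
apply: (poly_seq_eq0 ab) => u abu; rewrite horner_line_poly; apply: p0.
by exists u => //=; rewrite in_itv.
Qed.

(** The equations of any closed set containing [S] vanish on [S], hence on [Z]. *)
Lemma zariski_closure_eq S Z : zariski_closed Z -> S `<=` Z ->
  (forall p, vanish p S -> vanish p Z) -> zariski_closure S = Z.
Proof.
move=> Zcl SZ pZ; apply/seteqP; split; first exact: smallest_sub.
move=> M ZM _ [[P ->] SP] p Pp; apply: pZ ZM => N /SP; exact.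
Qed.

Lemma not_vanish Z C : zariski_closed C -> ~ Z `<=` C ->
  exists p, vanish p C /\ ~ vanish p Z.
Proof.
move=> [P ->] /existsNP[M /not_implyP[ZM /existsNP[p /not_implyP[Pp pM]]]].
by exists p; split=> [N CN|/(_ M ZM)//]; exact: CN.
Qed.

(** Otherwise the traces of [B] and [B'] on [C] would be proper closed subsets covering [C]. *)
Lemma zariski_irreducibleU C B B' : zariski_irreducible C ->
  zariski_closed C -> zariski_closed B -> zariski_closed B' ->
  C `<=` B `|` B' -> C `<=` B \/ C `<=` B'.
Proof.
move=> [_ Cirr] Ccl Bcl B'cl CBB'; apply: contrapT => /not_orP[CB CB'].
apply: Cirr; exists (C `&` B), (C `&` B'); split.
- exact: zariski_closedI.
- exact: zariski_closedI.
- by split=> [M []//|CCB]; apply: CB => M /CCB[].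
- by split=> [M []//|CCB]; apply: CB' => M /CCB[].
by rewrite -setIUr; apply/esym/setIidPl.
Qed.

Lemma zariski_irreducible_line A D : zariski_irreducible (mxline A D).
Proof.
split; first by exists A; exists 0 => //; rewrite scale0r addr0.
move=> [B [C [Bcl Ccl [BL LB] [CL LC] LE]]].
have [p [pB pL]] := not_vanish Bcl LB; have [q [qC qL]] := not_vanish Ccl LC.
(* An equation of [B] and one of [C] restrict to polynomials whose product has infinitely many
   roots; as [{poly R}] is a domain, one restriction is zero, a contradiction. *)
have : line_poly A D p * line_poly A D q = 0.
  apply: (@poly_seq_eq0 _ 0 1) => // t _; rewrite hornerM !horner_line_poly.
  have : (B `|` C) (A + t *: D) by rewrite -LE; exact: mem_line.
  by case=> [/pB|/qC] ->; rewrite ?mul0r ?mulr0.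
move=> /eqP; rewrite mulf_eq0 => /orP[]/eqP pq0.
  by apply: pL => _ [t _ <-]; rewrite -horner_line_poly pq0 horner0.
by apply: qL => _ [t _ <-]; rewrite -horner_line_poly pq0 horner0.
Qed.

Lemma zariski_irreducible1 A : zariski_irreducible [set A].
Proof. by rewrite -mxline0; exact: zariski_irreducible_line. Qed.

Lemma zariski_irreducible_finite C (s : seq 'M[R]_n) :
  zariski_closed C -> zariski_irreducible C -> C `<=` [set` s] ->
  exists A, C `<=` [set A].
Proof.
move=> Ccl Cirr; elim: s => [|A s IHs] Cs.
  by have [[M /Cs]] := Cirr.
have [|CA|/IHs//] := zariski_irreducibleU Cirr Ccl
  (zariski_closed1 A) (zariski_closed_seq s).
  by move=> M /Cs /=; rewrite inE => /orP[/eqP|]; [left|right].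
by exists A.
Qed.

(** Some equation of [C] restricts to a nonzero polynomial on the line, and its roots parametrize a
    finite set containing [C]. *)
Lemma zariski_closed_proper_line C A D : zariski_closed C ->
  C `<` mxline A D -> exists s : seq 'M[R]_n, C `<=` [set` s].
Proof.
move=> Ccl [CL LC]; have [p [pC pL]] := not_vanish Ccl LC.
have /poly_roots_seq[s ps] : line_poly A D p != 0.
  apply/eqP => p0; apply: pL => _ [t _ <-].
  by rewrite -horner_line_poly p0 horner0.
exists [seq A + t *: D | t <- s] => M CM /=; have [t _ tM] := CL M CM.
rewrite -tM; apply: (map_f (fun t => A + t *: D)); apply: ps.
by rewrite /root horner_line_poly tM pC.
Qed.

Lemma zariski_dim_lines A D A' D' : D != 0 ->
  zariski_dim (mxline A D `|` mxline A' D') 1.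
Proof.
move=> D0; split.
  exists (fun k => if k is 0%N then [set A] else mxline A D).
  split=> [[|k] _|[|k]//_].
  - split; [exact: zariski_closed1|exact: zariski_irreducible1|move=> _ ->].
    by left; exists 0 => //; rewrite scale0r addr0.
  - by split; [exact: zariski_closed_line|exact: zariski_irreducible_line|left].
  - split=> [_ ->|LA]; first by exists 0 => //; rewrite scale0r addr0.
    have /= /eqP := LA _ (mem_line A D 1).
    by rewrite scale1r -subr_eq0 addrAC subrr add0r (negbTE D0).
(* A chain of length at least two has strict steps from [C 0] to [C 1] to [C 2]. By irreducibility
   [C 2] lies in one line, so [C 1] is finite, hence inside a point, and the nonempty [C 0] cannot
   be smaller. *)
move=> m C [Cirr Clt]; rewrite leqNgt; apply/negP => m2.
have [C0cl [C0ne _] _] := Cirr 0%N (leq0n m).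
have [C1cl C1irr _] := Cirr 1%N (ltnW m2).
have [C2cl C2irr C2L] := Cirr 2%N m2.
have [C01 C10] := Clt 0%N (ltnW m2); have [C12 C21] := Clt 1%N m2.
have [s C1s] : exists s : seq 'M[R]_n, C 1%N `<=` [set` s].
  have [] := zariski_irreducibleU C2irr C2cl (zariski_closed_line A D)
    (zariski_closed_line A' D') C2L => C2L';
    apply: zariski_closed_proper_line C1cl (conj _ _).
  - exact: subset_trans C12 C2L'.
  - by move=> LC1; apply: C21; exact: subset_trans C2L' LC1.
  - exact: subset_trans C12 C2L'.
  - by move=> LC1; apply: C21; exact: subset_trans C2L' LC1.
have [M C1M] := zariski_irreducible_finite C1cl C1irr C1s.
apply: C10 => N C1N; have [N' C0N'] := C0ne.
by rewrite (C1M N C1N) -(C1M N' (C01 _ C0N')).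
Qed.

End ZariskiLines.

Theorem proposition3p29 (R : realType) (n : nat) (G H : sgraph n)
    (i j k : 'I_n) (hij : i != j) (hjk : j != k) (hik : i != k)
    (hGH : (edges G :&: edges H)%SET = [set edge i j; edge j k]%SET) :
  [/\ (edge i k \in (edges G :\: edges H)%SET ->
        dmodel R G H = model_inv R (graphI G H)),
      (edge i k \in (edges H :\: edges G)%SET ->
        dmodel R G H = model R (graphI G H))
    & (edge i k \notin (edges G :|: edges H)%SET ->
        [/\ dmodel1 R G H =
              [set 1%:M + t *: Esym R i j | t in `](-1), 1[ ] `|`
              [set 1%:M + t *: Esym R j k | t in `](-1), 1[ ],
            exists L1 L2 : set 'M[R]_n,
              [/\ is_line L1, is_line L2,
                  zariski_closure (dmodel1 R G H) = L1 `|` L2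
                & L1 `&` L2 = [set 1%:M]],
            connected (dmodel1 R G H),
            semialg_dim (dmodel1 R G H) 1
          & zariski_reducible (zariski_closure (dmodel1 R G H))])].
Proof.
split.
- exact: (dmodel_path_inv R (F := graphI G H) hGH hGH).
- exact: (dmodel_path R (F := graphI G H) hGH hGH).
move=> hik'; have modelE := dmodel1_path R hij hjk hik hGH hik'.
pose L1 := mxline 1%:M (Esym R i j); pose L2 := mxline 1%:M (Esym R j k).
have closureE : zariski_closure (dmodel1 R G H) = L1 `|` L2.
  rewrite modelE; apply: zariski_closure_eq.
  - by apply: zariski_closedU; exact: zariski_closed_line.
  - by move=> _ [] [t _ <-]; [left|right]; exact: mem_line.
  have seg01 : (-1 : R) < 1 by rewrite -subr_gt0 opprK.
  move=> p p0 M [] L; apply: (vanish_line seg01) L => N N0; apply: p0;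
    [left|right]; exact: N0.
have Eij0 : Esym R i j != 0 by exact: Esym_neq0.
have Ejk0 : Esym R j k != 0 by exact: Esym_neq0.
have L12 : L1 `&` L2 = [set 1%:M].
  apply/seteqP; split=> [_ [[t _ <-] [u _]]|_ ->].
    (* At the entry [(i, j)] the first direction is 1 and the second 0, so [t = 0]. *)
    move=> /addrI/matrixP/(_ i j); rewrite !mxE !eqxx (negbTE hij) (negbTE hik).
    by rewrite /= !addr0 mulr0 mulr1 => <-; rewrite scale0r addr0.
  by split; exists 0 => //; rewrite scale0r addr0.
(* A line with nonzero direction has a second point; as the two lines meet only in the identity,
   neither contains the other, whence reducibility. *)
have sub1 A : A != 0 -> ~ mxline (1%:M : 'M[R]_n) A `<=` [set 1%:M].
  move=> A0 /(_ _ (mem_line _ _ 1))/= /eqP.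
  by rewrite scale1r -subr_eq0 addrAC subrr add0r (negbTE A0).
split.
- exact: modelE.
- exists L1, L2; split=> //; first by exists 1%:M, (Esym R i j).
  by exists 1%:M, (Esym R j k).
- rewrite modelE; apply: connectedU; [|exact: segment_connected..].
  (* Both segments pass through the identity at parameter 0. *)
  have seg0 : (0 : R) \in `](-1), 1[ by rewrite in_itv /= oppr_lt0 ltr01.
  by exists 1%:M; split; exists 0; rewrite // scale0r addr0.
- rewrite /semialg_dim closureE; exact: zariski_dim_lines.
rewrite closureE; exists L1, L2; split=> //; first exact: zariski_closed_line.
- exact: zariski_closed_line.
- split=> [M|L21]; first by left.
  apply: (sub1 _ Ejk0); rewrite -L12 => M L2M; split=> //.
  by apply: L21; right.
- split=> [M|L21]; first by right.
  apply: (sub1 _ Eij0); rewrite -L12 => M L1M; split=> //.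
  by apply: L21; left.
Qed.
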